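(* Let $E$ be a real Banach space of dimension at least $2$ and let $G\subsetneq E$ be a domain. Then $G$ is $c$-uniform for some $c\ge1$ if and only if $G$ is diameter $c_1$-uniform for some $c_1\ge1$ and $\psi$-uniform for some strictly increasing homeomorphism $\psi:[0,\infty)\to[0,\infty)$. In particular, a diameter uniform convex domain $G\subsetneq E$ (i.e. a convex domain that is diameter $c_1$-uniform for some $c_1\geq 1$) is $c$-uniform for some $c\ge1$.
   Context: A domain is a nonempty connected open set; the norm of $E$ is written $|\cdot|$; $\partial G$ is the norm boundary and $d_G(x)=\operatorname{dist}(x,\partial G)$ for $x\in G$. For an arc $\gamma$ and $x,z\in\gamma$, $\gamma[x,z]$ is the subarc between $x$ and $z$, and $\ell(\gamma)$ is the norm length. $c$-uniform ($c\ge1$ a number): each pair of points $x,y\in G$ can be connected by an arc $\gamma$ in $G$ with $\ell(\gamma)\le c|x-y|$ and $\min\{\ell(\gamma[x,z]),\ell(\gamma[z,y])\}\le c\,d_G(z)$ for all $z\in\gamma$. Diameter $c$-uniform ($c\ge1$): each pair of points $x_1,x_2\in G$ can be joined by an arc $\alpha$ in $G$ with $\operatorname{diam}\alpha\le c|x_1-x_2|$ and $\min_{j=1,2}\operatorname{diam}(\alpha[x_j,x])\le c\,d_G(x)$ for all $x\in\alpha$. Quasihyperbolic metric: $k_G(x,y)=\inf\int_\alpha\frac{|dz|}{d_G(z)}$, the infimum over all rectifiable curves $\alpha$ in $G$ joining $x$ and $y$. $\psi$-uniform ($\psi:[0,\infty)\to[0,\infty)$ a strictly increasing homeomorphism): $k_G(x,y)\le\psi(r_G(x,y))$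 for all $x,y\in G$, where $r_G(x,y)=\frac{|x-y|}{\min\{d_G(x),d_G(y)\}}$. *)

(* Defs.v *)
From mathcomp Require Import all_boot all_order all_algebra.
From mathcomp Require Import all_classical all_reals all_analysis.

Set Implicit Arguments.
Unset Strict Implicit.
Unset Printing Implicit Defensive.

Import Order.TTheory GRing.Theory Num.Theory.
Import numFieldNormedType.Exports.

Local Open Scope classical_set_scope.
Local Open Scope ring_scope.

(* E has (possibly infinite) dimension at least n. *)
Definition dim_ge (R : realType) (E : lmodType R) (n : nat) : Prop :=
  exists v : 'I_n -> E, forall a : 'I_n -> R,
    \sum_(i < n) a i *: v i = 0 -> forall i, a i = 0.

Definition homeomorphism_on (T U : topologicalType) (A : set T) (B : set U)
    (f : T -> U) : Prop :=
  exists g : U -> T,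
    [/\ {homo f : x / A x >-> B x}, {homo g : y / B y >-> A y},
        {in A, cancel f g} & {in B, cancel g f}] /\
    ({within A, continuous f} /\ {within B, continuous g}).

(* Only the values of psi on [0, +oo[ are relevant. *)
Definition increasing_homeomorphism (R : realType) (psi : R -> R) : Prop :=
  homeomorphism_on (`[0, +oo[ : set R) (`[0, +oo[ : set R) psi /\
  {in `[0, +oo[ &, {homo psi : s t / s < t}}.

Section curves.
Context (R : realType) (E : normedModType R).
Implicit Types (G A : set E) (gamma : R -> E) (a b t u : R) (x y z : E).

(* Curves and arcs are parametrized by compact intervals [a, b] with a <= b;
   when a = b they are single points, so that each point is joined to itself
   by a degenerate arc. *)
Definition curve_in G gamma a b x y : Prop :=
  [/\ a <= b, {within `[a, b], continuous gamma},
      gamma @` `[a, b] `<=` G, gamma a = x & gamma b = y].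

Definition arc_in G gamma a b x y : Prop :=
  curve_in G gamma a b x y /\ {in `[a, b] &, injective gamma}.

(* Same formula as [variation], which is restricted to real-valued maps. *)
Definition curve_variation gamma a b (s : seq R) : R :=
  let F := gamma \o nth b (a :: s) in
  \sum_(0 <= n < size s) `|F n.+1 - F n|.

Definition curve_length gamma a b : \bar R :=
  ereal_sup [set (curve_variation gamma a b s)%:E | s in itv_partition a b].

(* The arclength parametrization on [0, l] of a rectifiable curve of length l:
   it sends u to gamma t, where t is the first parameter such that the length
   of gamma on [a, t] reaches u. *)
Definition arclength_param gamma a b u : E :=
  gamma (inf [set t | t \in `[a, b] /\ (u%:E <= curve_length gamma a t)%E]).

(* The integral of rho |dz| along the restriction to [a, b] of a rectifiable
   curve. *)
Definition curve_integral (rho : E -> R) gamma a b : \bar R :=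
  (\int[lebesgue_measure]_(u in `[0%R, fine (curve_length gamma a b)])
     (rho (arclength_param gamma a b u))%:E)%E.

Definition diam A : \bar R :=
  ereal_sup [set `|x - y|%:E | x in A & y in A].

Definition bd G : set E := closure G `\` interior G.

Definition bdist G x : R := inf [set `|x - z| | z in bd G].

Definition domain G : Prop := [/\ G !=set0, open G & connected G].

Definition uniform_domain (c : R) G : Prop :=
  forall x y, G x -> G y ->
  exists gamma a b,
    [/\ arc_in G gamma a b x y,
        (curve_length gamma a b <= (c * `|x - y|)%:E)%E &
        forall t, t \in `[a, b] ->
          (Order.min (curve_length gamma a t) (curve_length gamma t b)
             <= (c * bdist G (gamma t))%:E)%E].

Definition diameter_uniform (c : R) G : Prop :=
  forall x y, G x -> G y ->
  exists gamma a b,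
    [/\ arc_in G gamma a b x y,
        (diam (gamma @` `[a, b]) <= (c * `|x - y|)%:E)%E &
        forall t, t \in `[a, b] ->
          (Order.min (diam (gamma @` `[a, t])) (diam (gamma @` `[t, b]))
             <= (c * bdist G (gamma t))%:E)%E].

Definition quasihyperbolic G x y : \bar R :=
  ereal_inf [set k | exists gamma a b,
    [/\ curve_in G gamma a b x y, (curve_length gamma a b < +oo)%E &
        k = curve_integral (fun z => (bdist G z)^-1) gamma a b]].

Definition relative_distance G x y : R :=
  `|x - y| / Num.min (bdist G x) (bdist G y).

Definition psi_uniform (psi : R -> R) G : Prop :=
  forall x y, G x -> G y ->
    (quasihyperbolic G x y <= (psi (relative_distance G x y))%:E)%E.

End curves.

(* Main.v *)
Require Import Defs.
From mathcomp Require Import all_boot all_order all_algebra.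
From mathcomp Require Import all_classical all_reals all_analysis.
From mathcomp Require Import ring lra.

Import Order.TTheory GRing.Theory Num.Theory.
Import numFieldNormedType.Exports.

Local Open Scope classical_set_scope.
Local Open Scope ring_scope.

Set Implicit Arguments.
Unset Strict Implicit.
Unset Printing Implicit Defensive.

(** The forward implication is soft: the diameter of an arc is at most its
    length, and the quasihyperbolic length of a uniform arc is at most its
    length divided by its least distance to the boundary
    ([uniform_psi_uniform]), which gives a linear [psi].

    For the converse, diameter uniformity enters through the following
    consequence ([diameter_uniform_thick_points]): for each [x] and each scale
    [rho <= `|x - y| / 2] there is a point [z] of [G] at distance [rho] from [x]
    and at distance at least [rho / c] from the boundary. Take such points at
    the scales [rho = `|x - y| / 2 ^ n], starting at a scale so small that a
    segment joins [x] to the first one. Consecutive points have bounded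
    relative distance, so [psi]-uniformity bounds their quasihyperbolic
    distance. A curve of bounded quasihyperbolic length has length comparable
    with, and stays at a distance from the boundary comparable with, the
    distance to the boundary of its endpoints ([curve_integral_growth]). So
    consecutive points at scale [rho] are joined by arcs of length at most
    [C * rho] and at distance at least [rho / C] from the boundary
    ([psi_uniform_linkable]). The lengths add up to a geometric series, hence
    the concatenated arc from [x] has, at each of its points, length bounded by
    a constant times the distance to the boundary ([coned_thick_point]). Two
    such arcs, one from [x] and one from [y], both climbing to the scale
    [`|x - y| / 2], are finally linked to each other
    ([linkable_thick_uniform]).

    The definition of uniformity asks for injective arcs. All arcs are
    therefore built from segments, by a concatenation that leaves the first arc
    where it first meets the second one ([lip_arc_join]); a curve provided by
    the quasihyperbolic metric is replaced with an inscribed polygon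
    ([linked_curve]).

    In a convex domain the distance to the boundary along a segment is at least
    its minimum at the endpoints, so a convex domain is [psi]-uniform with
    [psi] the identity, and the equivalence applies. *)

(** * Integrals on the real line *)

(** The integral of a nonnegative function is a supremum over the simple
    functions below it, so it is monotone whether or not the functions are
    measurable; this covers integrands along the arclength parametrization, for
    which only pointwise bounds are at hand. *)
Lemma ge0_le_subset_integral d (T : measurableType d) (R : realType)
    (mu : {measure set T -> \bar R}) (A B : set T) (f g : T -> \bar R) :
  A `<=` B -> (forall u, A u -> (0 <= f u)%E) ->
  (forall u, B u -> (0 <= g u)%E) -> (forall u, A u -> (f u <= g u)%E) ->
  (\int[mu]_(u in A) f u <= \int[mu]_(u in B) g u)%E.
Proof.
move=> AB f0 g0 fg; rewrite !ge0_integralE//.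
apply: ereal_sup_le => _ [h hf <-]; exists h => // u.
apply: le_trans (hf u) _; rewrite /patch.
case: ifPn; rewrite ?inE => Au.
  by rewrite mem_set; [exact: fg|exact: AB].
by case: ifPn => //; rewrite inE => /g0.
Qed.

Section real_line.
Context (R : realType).

Lemma integral_le_const (L M : R) (f : R -> R) : 0 <= L ->
  (forall u, 0 <= u <= L -> 0 <= f u <= M) ->
  (\int[@lebesgue_measure R]_(u in `[0%R, L]) (f u)%:E <= (M * L)%:E)%E.
Proof.
move=> L0 fM.
have {}fM u : `[0, L]%classic u -> 0 <= f u <= M by rewrite /= in_itv => /fM.
have M0 : 0 <= M.
  have /fM/andP[] : `[0, L]%classic (0 : R) by rewrite /= in_itv /= lexx.
  exact: le_trans.
apply: (@le_trans _ _
  (\int[@lebesgue_measure R]_(u in `[0%R, L]) (cst M u)%:E)%E).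
  by apply: ge0_le_subset_integral => // u /fM /andP[f0 fM'];
    rewrite lee_fin.
rewrite (integral_cst _ _ M%:E)//= lebesgue_measure_itv /= lte_fin.
case: ltP => [_|?]; last by rewrite mule0 lee_fin mulr_ge0.
by rewrite -EFinD -EFinM subr0.
Qed.

Lemma integral_inv_affine (d v : R) : 0 < d -> 0 <= v ->
  (\int[@lebesgue_measure R]_(u in `[0%R, v]) ((d + (v - u))^-1)%:E =
   (ln ((d + v) / d))%:E)%E.
Proof.
move=> d0; rewrite le_eqVlt => /predU1P[<-|v0].
  by rewrite set_itv1 integral_set1 addr0 divff ?gt_eqF// ln1.
have pos u : u <= v -> 0 < d + (v - u) by move=> ?; lra.
have dF u : u <= v ->
    is_derive u (1 : R) (fun u => - ln (d + (v - u))) ((d + (v - u))^-1).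
  move=> uv; have p := pos u uv.
  have H : is_derive u (1 : R) (fun u => d + (v - u)) (-1).
    by apply: is_derive_eq; rewrite !add0r !mul1r.
  have K : is_derive u (1 : R) (@ln R \o (fun u => d + (v - u)))
      (- (d + (v - u))^-1).
    rewrite -mulrN1; have L := is_derive1_ln p; exact: is_derive1_comp.
  by have := is_deriveN K; rewrite opprK.
have cF u : u <= v -> {for u, continuous (fun u => - ln (d + (v - u)))}.
  move=> uv; apply: differentiable_continuous; apply/derivable1_diffP.
  exact: (@ex_derive _ _ _ _ _ _ _ (dF u uv)).
rewrite (@continuous_FTC2 _ _ (fun u => - ln (d + (v - u)))) //.
- rewrite subrr addr0 subr0 -EFinD opprK addrC ln_div ?posrE//; lra.
- apply: continuous_in_subspaceT => u; rewrite inE /= in_itv /= => /andP[_ uv].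
  apply: cvgV; first by rewrite gt_eqF// pos.
  by apply: cvgD; [exact: cvg_cst|apply: cvgB; [exact: cvg_cst|exact: cvg_id]].
- split => [u||].
  + rewrite in_itv /= => /andP[_ /ltW uv].
    exact: (@ex_derive _ _ _ _ _ _ _ (dF u uv)).
  + by apply: cvg_at_right_filter; exact: cF (ltW v0).
  + by apply: cvg_at_left_filter; exact: cF.
- move=> u; rewrite in_itv /= => /andP[_ /ltW uv].
  by rewrite derive1E (@derive_val _ _ _ _ _ _ _ (dF u uv)).
Qed.

End real_line.

(** * Length of curves *)

Section curve_length.
Context (R : realType) (E : normedModType R).
Implicit Types (gamma : R -> E) (a b s t : R) (p : seq R).

Lemma curve_variation_cons gamma a b x p :
  curve_variation gamma a b (x :: p) =
  `|gamma x - gamma a| + curve_variation gamma x b p.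
Proof. by rewrite /curve_variation big_nat_recl. Qed.

Lemma curve_variation_rcons gamma a s t p : itv_partition a s p ->
  curve_variation gamma a t (rcons p t) =
  curve_variation gamma a s p + `|gamma t - gamma s|.
Proof.
elim: p a => [a /itv_partition_nil ->|x p IH a].
  by rewrite /= curve_variation_cons /curve_variation !big_geq// addr0 add0r.
move/itv_partition_cons => xp.
by rewrite rcons_cons !curve_variation_cons IH// addrA.
Qed.

Lemma curve_lengthxx gamma a : curve_length gamma a a = 0%E.
Proof.
rewrite /curve_length [X in ereal_sup X](_ : _ = [set 0%E]) ?ereal_sup1//.
apply/seteqP; split => [_ [p /itv_partitionxx -> <-]|_ ->].
  by rewrite /curve_variation big_geq.
exists [::]; first by split => //=.
by rewrite /curve_variation big_geq.
Qed.

(** A partition of [[a, s]] extended by [t] is a partition of [[a, t]]. This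
    inequality is the source of all lower bounds on lengths below. *)
Lemma curve_length_add_dist gamma a s t : s <= t ->
  (curve_length gamma a s + `|gamma t - gamma s|%:E
    <= curve_length gamma a t)%E.
Proof.
rewrite le_eqVlt => /predU1P[->|st]; first by rewrite subrr normr0 adde0.
rewrite -leeBrDr//; apply: ge_ereal_sup => _ [p ps <-].
rewrite leeBrDr// -EFinD -(curve_variation_rcons _ t ps).
apply: ereal_sup_ubound; exists (rcons p t) => //.
rewrite -cats1; apply: itv_partition_cat ps _; exact: itv_partition1.
Qed.

Lemma curve_length_ge0 gamma a b : a <= b -> (0 <= curve_length gamma a b)%E.
Proof.
move=> ab; apply: le_trans (curve_length_add_dist gamma a ab).
by rewrite curve_lengthxx add0e.
Qed.

Lemma curve_length_le gamma a s t : s <= t ->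
  (curve_length gamma a s <= curve_length gamma a t)%E.
Proof.
move=> st; apply: le_trans (curve_length_add_dist gamma a st).
by rewrite leeDl.
Qed.

Lemma dist_le_curve_length gamma a b s t : a <= s -> s <= t -> t <= b ->
  (`|gamma t - gamma s|%:E <= curve_length gamma a b)%E.
Proof.
move=> as_ st tb; apply: le_trans (curve_length_le gamma a tb).
apply: le_trans (curve_length_add_dist gamma a st).
by rewrite leeDr// curve_length_ge0.
Qed.

Lemma diam_le_curve_length gamma a b :
  (diam (gamma @` `[a, b]) <= curve_length gamma a b)%E.
Proof.
apply: ge_ereal_sup => _ [_ [s + <-] [_ [t + <-] <-]].
rewrite /= !in_itv /= => /andP[as_ sb] /andP[at_ tb].
have [st|/ltW ts] := leP s t; first by rewrite distrC dist_le_curve_length.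
exact: dist_le_curve_length.
Qed.

Lemma curve_length_lipschitz gamma a b : a <= b ->
  (forall s t, a <= s -> s <= t -> t <= b -> `|gamma t - gamma s| <= t - s) ->
  (curve_length gamma a b <= (b - a)%:E)%E.
Proof.
move=> ab lip; apply: ge_ereal_sup => _ [p ap <-]; rewrite lee_fin.
elim: p a ab lip ap => [a ab _ _|x p IH a ab lip axp].
  by rewrite /curve_variation big_geq// subr_ge0.
have xp := itv_partition_cons axp; have xb := itv_partition_le xp.
have ax : a <= x by have [/= /andP[/ltW]] := axp.
have -> : b - a = (x - a) + (b - x) by lra.
rewrite curve_variation_cons lerD//; first exact: lip.
by apply: IH => // s t xs; apply: lip; exact: le_trans xs.
Qed.

(** A real-valued version of the length of [gamma] on the intervals [[a, t]],
    so that the inequalities between lengths can be solved in [R] rather than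
    in the extended reals. *)
Definition rectifiable_length gamma a b (len : R -> R) :=
  [/\ forall t, a <= t <= b -> curve_length gamma a t = (len t)%:E,
      len a = 0 &
      forall s t, a <= s -> s <= t -> t <= b ->
        len s + `|gamma t - gamma s| <= len t].

Lemma curve_length_finite gamma a b : a <= b ->
  (curve_length gamma a b < +oo)%E ->
  rectifiable_length gamma a b (fun t => fine (curve_length gamma a t)).
Proof.
move=> ab fin.
have E1 t : a <= t <= b ->
    curve_length gamma a t = (fine (curve_length gamma a t))%:E.
  move=> /andP[at_ tb]; rewrite fineK// ge0_fin_numE ?curve_length_ge0//.
  exact: le_lt_trans (curve_length_le _ _ tb) fin.
split => // [|s t as_ st tb]; first by rewrite curve_lengthxx.
rewrite -lee_fin EFinD -!E1 ?curve_length_add_dist ?as_ ?tb ?(le_trans st)//.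
by rewrite (le_trans as_).
Qed.

End curve_length.

(** * Distance to the boundary *)

Section boundary_distance.
Context (R : realType) (E : normedModType R) (G : set E).
Hypotheses (domG : domain G) (properG : G `<` setT).

Let openG : open G. Proof. by case: domG. Qed.

Lemma bd_open z : bd G z -> ~ G z.
Proof. by case=> _; rewrite (interior_id _).1. Qed.

(** A segment is connected, so one that avoids the boundary of the open set [G]
    has a relatively clopen intersection with [G]. This gives both the
    nonemptiness of the boundary, without which [bdist] would be an infimum
    over the empty set, and the inclusion of the ball of radius [bdist G x] in
    [G]. *)
Lemma segment_meets_bd x y : G x -> ~ G y ->
  exists2 t, 0 <= t <= 1 & bd G (x + t *: (y - x)).
Proof.
move=> Gx nGy; apply: contrapT => H; apply: nGy.
pose f (t : R) := x + t *: (y - x).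
have cf : continuous f.
  by move=> t; apply: cvgD; [exact: cvg_cst|exact: cvgZr_tmp cvg_id].
have con : connected (f @` `[0, 1]).
  apply: connected_continuous_connected; first exact: segment_connected.
  exact: continuous_subspaceT.
suff : (f @` `[0, 1]) `&` G = f @` `[0, 1].
  move=> e; have : (f @` `[0, 1]) y.
    by exists 1; rewrite /= ?in_itv /= ?lexx ?ler01// /f scale1r addrC subrK.
  by rewrite -e => -[].
apply: con.
- exists x; split => //.
  by exists 0; rewrite /= ?in_itv /= ?lexx ?ler01// /f scale0r addr0.
- by exists G.
- exists (closure G); first exact: closed_closure.
  apply/seteqP; split => [z [fz Gz]|z [fz cz]]; split => //.
    exact: subset_closure.
  apply: contrapT => nGz; apply: H; case: fz => t.
  rewrite /= in_itv /= => t01 ft.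
  by exists t => //; rewrite -/(f t) ft; split => //; rewrite (interior_id _).1.
Qed.

Lemma bd_neq0 : bd G !=set0.
Proof.
have [[x Gx] _ _] := domG; have [_ nTG] := properG.
have [y nGy] : exists y, ~ G y.
  by apply/existsNP => GT; apply: nTG => y _; exact: GT.
by have [t _ ?] := segment_meets_bd Gx nGy; eexists; eassumption.
Qed.

Let has_lb x : has_lbound [set `|x - z| | z in bd G].
Proof. by exists 0 => _ [z _ <-]. Qed.

Lemma bdist_le x z : bd G z -> bdist G x <= `|x - z|.
Proof. by move=> bz; apply: ge_inf => //; exists z. Qed.

Lemma le_bdist x r : (forall z, bd G z -> r <= `|x - z|) -> r <= bdist G x.
Proof.
move=> H; apply: lb_le_inf; last by move=> _ [z /H ? <-].
by have [z bz] := bd_neq0; exists `|x - z|; exists z.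
Qed.

Lemma bdist_lip x y : bdist G x <= bdist G y + `|x - y|.
Proof.
rewrite -lerBlDr; apply: le_bdist => z bz; rewrite lerBlDr.
apply: le_trans (bdist_le x bz) _; rewrite [leRHS]addrC; exact: ler_distD.
Qed.

Lemma bdist_ball x r : (forall y, `|x - y| < r -> G y) -> r <= bdist G x.
Proof.
by move=> H; apply: le_bdist => z /bd_open nGz; rewrite leNgt; apply/negP => /H.
Qed.

Lemma ball_bdist x y : G x -> `|x - y| < bdist G x -> G y.
Proof.
move=> Gx xy; apply: contrapT => nGy.
have [t /andP[t0 t1] /(bdist_le x)] := segment_meets_bd Gx nGy.
rewrite leNgt => /negP; apply; apply: le_lt_trans xy.
rewrite opprD addrA subrr sub0r normrN normrZ (distrC x) ger0_norm//.
by rewrite ler_piMl.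
Qed.

Lemma bdist_gt0 x : G x -> 0 < bdist G x.
Proof.
move=> Gx; have := open_nbhs_nbhs (conj openG Gx).
move=> /nbhs_ballP[r /= r0 H].
apply: lt_le_trans r0 _; apply: bdist_ball => y xy; apply: H.
by rewrite -ball_normE.
Qed.

End boundary_distance.

(** * The arclength parametrization and the quasihyperbolic metric *)

Section curves_of_finite_length.
Context (R : realType) (E : normedModType R).
Implicit Types (gamma : R -> E) (a b s t u : R).

Lemma within_itv_continuousP gamma a b : {within `[a, b], continuous gamma} <->
  forall t e, a <= t <= b -> 0 < e -> exists2 h, 0 < h &
    forall s, a <= s <= b -> `|t - s| < h -> `|gamma t - gamma s| < e.
Proof.
rewrite subspace_continuousP; split => [cg t e tab e0|H t /= tab].
  have := cg t; rewrite /= in_itv /= => /(_ tab) /cvgrPdist_lt /(_ e e0).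
  rewrite near_withinE => /nbhs_ballP[h /= h0 H]; exists h => // s sab ts.
  by apply: (H s); rewrite /= ?in_itv//= -ball_normE.
apply/cvgrPdist_lt => e e0; rewrite near_withinE.
move: tab; rewrite in_itv /= => tab.
have [h h0 Hh] := H t e tab e0; apply/nbhs_ballP; exists h => //= s.
by rewrite -ball_normE /= in_itv /= => ts sab; exact: Hh.
Qed.

(** Both estimates of quasihyperbolic lengths rest on this: the point at
    arclength [u] lies on the curve before [gamma t], at distance at most
    [len t - u] from it. The infimum that defines its parameter is perhaps not
    attained, and is approached from the right by parameters [s] with
    [u <= len s]; the estimate passes to the limit by continuity of
    [gamma]. *)
Lemma arclength_param_near gamma a b len u t :
  {within `[a, b], continuous gamma} -> rectifiable_length gamma a b len ->
  a <= t <= b -> u <= len t ->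
  exists2 t0, a <= t0 <= t & arclength_param gamma a b u = gamma t0 /\
    `|gamma t - gamma t0| <= len t - u.
Proof.
move=> /within_itv_continuousP cg [lenE _ lenD] /andP[at_ tb] ut.
set S := [set s | s \in `[a, b] /\ (u%:E <= curve_length gamma a s)%E].
have SP s : S s <-> a <= s <= b /\ u <= len s.
  split=> [[]|[]]; rewrite /S /= in_itv /= => sab; rewrite lenE// lee_fin//.
have St : S t by apply/SP; rewrite at_ tb.
have lbS : has_lbound S by exists a => s /SP[/andP[]].
have infS : has_inf S by split; [exists t|].
have at0 : a <= inf S by apply: lb_le_inf; [exists t|move=> s /SP[/andP[]]].
have t0t : inf S <= t by exact: ge_inf.
exists (inf S); first by rewrite at0.
split => //; apply/ler_addgt0Pr => e e0.
have [|h h0 H] := cg (inf S) e _ e0; first by rewrite at0 (le_trans t0t).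
have [s Ss st0] := inf_adherent h0 infS.
(* Cutting [s] off at [t] keeps it in [S] and within [h] of the infimum, and
   spares a discussion of whether [s] overshoots [t]. *)
have Sm : S (Num.min s t) by rewrite /Num.min; case: ifP.
have mt : Num.min s t <= t by rewrite ge_min lexx orbT.
have ms : Num.min s t <= s by rewrite ge_min lexx.
have m0 : inf S <= Num.min s t by exact: ge_inf.
have [mab um] := (SP _).1 Sm; have /andP[am mb] := mab.
have d1 := lenD _ _ am mt tb.
have d2 : `|inf S - Num.min s t| < h.
  by rewrite distrC ger0_norm ?subr_ge0//; lra.
have {}d2 := H _ mab d2.
have := ler_distD (gamma (Num.min s t)) (gamma t) (gamma (inf S)).
rewrite (distrC (gamma (Num.min s t))); lra.
Qed.

End curves_of_finite_length.

Section quasihyperbolic_estimates.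
Context (R : realType) (E : normedModType R) (G : set E).
Hypotheses (domG : domain G) (properG : G `<` setT).
Implicit Types (gamma : R -> E) (a b s t u : R).

Let inv_bdist z := (bdist G z)^-1.

Lemma quasihyperbolic_le gamma a b x y (L r : R) : curve_in G gamma a b x y ->
  (curve_length gamma a b <= L%:E)%E -> 0 < r ->
  (forall t, a <= t <= b -> r <= bdist G (gamma t)) ->
  (quasihyperbolic G x y <= (L / r)%:E)%E.
Proof.
move=> crv lenL r0 far; have [ab cont sub gax gby] := crv.
have fin : (curve_length gamma a b < +oo)%E by exact: le_lt_trans lenL (ltry _).
have rl := curve_length_finite ab fin; have [lenE len0 _] := rl.
set len := fun t => fine (curve_length gamma a t) in rl lenE len0.
have len_ge0 : 0 <= len b.
  by rewrite -lee_fin -lenE ?ab ?lexx// curve_length_ge0.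
apply: (@le_trans _ _ (r^-1 * len b)%:E); last first.
  rewrite lee_fin mulrC ler_wpM2r ?invr_ge0 ?(ltW r0)// -lee_fin -lenE//.
  by rewrite ab lexx.
apply: (@le_trans _ _ (curve_integral inv_bdist gamma a b)).
  by apply: ereal_inf_lbound; exists gamma, a, b; split.
apply: integral_le_const => // u /andP[u0 ub].
have [|t0 /andP[at0 t0b] [-> _]] := arclength_param_near cont rl _ ub.
  by rewrite ab lexx.
have rt : r <= bdist G (gamma t0) by apply: far; rewrite at0.
by rewrite invr_ge0 lef_pV2 ?posrE ?(lt_le_trans r0)// rt (le_trans (ltW r0)).
Qed.

(** With [w := gamma t] and [d := bdist G w], the points of the curve at
    arclength [u <= len t] are within [len t - u] of [w], hence within
    [d + (len t - u)] of the boundary. So the quasihyperbolic length of the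
    curve is at least the integral of [(d + (len t - u))^-1], which is
    [ln ((d + len t) / d)]. Taking [t := b] bounds the length of the curve, and
    comparing with its origin bounds [bdist G] from below along it. *)
Lemma curve_integral_growth gamma a b x y len (K : R) :
  curve_in G gamma a b x y -> rectifiable_length gamma a b len ->
  (curve_integral inv_bdist gamma a b <= K%:E)%E ->
  forall t, a <= t <= b ->
    bdist G (gamma t) + len t <= expR K * bdist G (gamma t).
Proof.
move=> [ab cont sub gax gby] rl leK t tab; have [lenE len0 lenD] := rl.
have /andP[at_ tb] := tab.
have Gg s : a <= s <= b -> G (gamma s).
  by move=> sab; apply: sub; exists s => //=; rewrite in_itv.
have dw := bdist_gt0 domG properG (Gg _ tab).
have lent0 : 0 <= len t.
  by have := lenD _ _ (lexx _) at_ tb; rewrite len0 add0r; exact: le_trans.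
have lentb : len t <= len b.
  by apply: le_trans (lenD _ _ at_ tb (lexx _)); rewrite lerDl.
set d := bdist G (gamma t) in dw *.
suff : ln ((d + len t) / d) <= K.
  move=> lnleK; rewrite -ler_pdivrMr// -[leLHS]lnK ?ler_expR// posrE divr_gt0//.
  lra.
rewrite -lee_fin -integral_inv_affine//; apply: le_trans leK.
rewrite /curve_integral lenE ?ab ?lexx//=.
apply: ge0_le_subset_integral.
- by apply: subset_itvl; rewrite bnd_simp.
- move=> u; rewrite /= in_itv /= => /andP[u0 ut].
  by rewrite lee_fin invr_ge0; lra.
- move=> u; rewrite /= in_itv /= => /andP[u0 ub].
  have [|s /andP[as_ sb] [-> _]] := arclength_param_near cont rl _ ub.
    by rewrite ab lexx.
  by rewrite lee_fin invr_ge0 ltW// bdist_gt0//; apply: Gg; rewrite as_.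
- move=> u; rewrite /= in_itv /= => /andP[u0 ut].
  have [s /andP[as_ st] [-> dist]] := arclength_param_near cont rl tab ut.
  have ds : 0 < bdist G (gamma s).
    by apply: bdist_gt0 => //; apply: Gg; rewrite as_ (le_trans st).
  have := bdist_lip domG properG (gamma s) (gamma t).
  rewrite distrC -/d => lip; rewrite lee_fin lef_pV2 ?posrE//; lra.
Qed.

End quasihyperbolic_estimates.

(** * Arcs with a 1-Lipschitz parametrization *)

Section lipschitz_arcs.
Context (R : realType) (E : normedModType R).
Implicit Types (g : R -> E) (l s t : R) (x y z : E).

(** An arc from [x] to [y] with a 1-Lipschitz parametrization by [[0, l]]: the
    length of each of its subarcs is at most the length of the parameter
    interval, so gluing and reversing arcs does not require computing any
    length. *)
Definition lip_arc g l x y :=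
  [/\ 0 <= l, g 0 = x, g l = y,
      forall s t, 0 <= s -> s <= t -> t <= l -> `|g t - g s| <= t - s &
      forall s t, 0 <= s -> s < t -> t <= l -> g s <> g t].

Lemma lip_arc_segment x y :
  lip_arc (fun t => x + (t / `|y - x|) *: (y - x)) `|y - x| x y.
Proof.
set l := `|y - x|; set g := fun t => _.
have gB s t : g t - g s = ((t - s) / l) *: (y - x).
  by rewrite /g opprD addrACA subrr add0r -scalerBl -mulrBl.
have lge0 : 0 <= l by exact: normr_ge0.
have [l0|l0] := eqVneq l 0.
  split => //.
  - by rewrite /g mul0r scale0r addr0.
  - rewrite /g l0 mul0r scale0r addr0; apply/esym/eqP.
    by rewrite -subr_eq0 -normr_eq0 -/l l0.
  - move=> s t s0 st tl; rewrite gB normrZ -/l l0 mulr0; lra.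
  - move=> s t; rewrite l0 => ? ? ? _; lra.
have lgt : 0 < l by rewrite lt_neqAle eq_sym l0.
split => //.
- by rewrite /g mul0r scale0r addr0.
- by rewrite /g divff// scale1r addrC subrK.
- move=> s t s0 st tl; rewrite gB normrZ -/l ger0_norm ?divfK//.
  by rewrite divr_ge0 ?subr_ge0.
- move=> s t s0 st tl /eqP; rewrite -subr_eq0 -opprB oppr_eq0 gB scaler_eq0.
  rewrite mulf_eq0 invr_eq0 -(normr_eq0 (y - x)) -/l (negPf l0) !orbF.
  by rewrite subr_eq0 gt_eqF.
Qed.

Lemma lip_arc_rev g l x y :
  lip_arc g l x y -> lip_arc (fun t => g (l - t)) l y x.
Proof.
move=> [l0 g0 gl lip inj]; split; rewrite ?subr0 ?subrr//.
  move=> s t s0 st tl; rewrite distrC.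
  have -> : t - s = (l - s) - (l - t) by lra.
  by apply: lip; lra.
by move=> s t s0 st tl /esym; apply: inj; lra.
Qed.

Lemma lip_arc_continuous g l x y :
  lip_arc g l x y -> {within `[0, l], continuous g}.
Proof.
move=> [_ _ _ lip _]; apply/within_itv_continuousP => t e tl e0.
exists e => // s sl; apply: le_lt_trans.
by have [st|/ltW st] := leP s t; [rewrite ger0_norm|rewrite distrC ler0_norm];
  rewrite ?opprB; try apply: lip; lra.
Qed.

(** Concatenating two arcs need not give an arc. Leaving the first arc at the
    first point where it meets the second one, and following the second arc
    from there, does; the first meeting point exists because the second arc is
    compact. In the conclusion, [t] and [l - t] bound the lengths of the two
    parts into which [g t] cuts the new arc: before the junction the initial
    part is unchanged, after it the final part is unchanged. *)
Lemma lip_arc_join g1 l1 g2 l2 x y z :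
  lip_arc g1 l1 x y -> lip_arc g2 l2 y z ->
  exists g l, lip_arc g l x z /\ l <= l1 + l2 /\
    forall t, 0 <= t <= l ->
      (t <= l1 /\ g t = g1 t) \/
      exists2 s, 0 <= s <= l2 /\ g t = g2 s & t <= l1 + s /\ l - t = l2 - s.
Proof.
move=> a1 a2; have [l10 g10 g1l lip1 inj1] := a1.
have [l20 g20 g2l lip2 inj2] := a2.
pose C := g2 @` `[0, l2].
have closedC : closed C.
  apply: compact_closed; first exact: norm_hausdorff.
  exact: continuous_compact (lip_arc_continuous a2) (@segment_compact _ _ _).
pose S := [set t | 0 <= t <= l1 /\ C (g1 t)].
have Sl1 : S l1.
  by split; [rewrite l10 lexx|exists 0; rewrite /= ?in_itv /= ?lexx// g20].
have infS : has_inf S by split; [exists l1|exists 0 => t [/andP[]]].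
have t0l1 : inf S <= l1 by apply: ge_inf => //; case: infS.
have t00 : 0 <= inf S by apply: lb_le_inf => [|t [/andP[]]//]; exists l1.
have minS t : S t -> inf S <= t by move=> St; apply: ge_inf => //; case: infS.
set t0 := inf S in t0l1 t00 minS.
(* The infimum of the meeting times is a meeting time since [C] is closed. *)
have [s0 s0l2 g2s0] : C (g1 t0).
  rewrite [C](closure_id _).1// => B /nbhs_ballP[e /= e0 eB].
  have [t St tt0] := inf_adherent e0 infS; have [/andP[_ tl1] Ct] := St.
  exists (g1 t); split => //; apply: eB; rewrite -ball_normE /= distrC.
  apply: le_lt_trans (lip1 _ _ t00 (minS _ St) tl1) _.
  by rewrite -/t0 in tt0; lra.
move: s0l2; rewrite /= in_itv /= => /andP[s00 s0l2].
pose g t := if t <= t0 then g1 t else g2 (t - t0 + s0).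
have gl t : t <= t0 -> g t = g1 t by rewrite /g => ->.
have gr t : t0 <= t -> g t = g2 (t - t0 + s0).
  rewrite le_eqVlt => /predU1P[<-|tt0]; first by rewrite gl// subrr add0r.
  by rewrite /g leNgt tt0.
exists g, (t0 + l2 - s0); split; last split; last 2 first.
- lra.
- move=> t /andP[tpos tl]; have [tt0|/ltW tt0] := leP t t0.
    by left; rewrite gl//; split => //; lra.
  right; exists (t - t0 + s0); first by rewrite gr//; split => //; lra.
  by split; lra.
split.
- lra.
- by rewrite gl.
- rewrite (gr (t0 + l2 - s0)); last lra.
  rewrite -g2l; congr g2; lra.
- move=> s t spos st tl; have [tt0|/ltW tt0] := leP t t0.
    by rewrite !gl//; [apply: lip1|]; lra.
  have [st0|/ltW st0] := leP s t0; last first.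
    rewrite !gr//; have -> : t - s = (t - t0 + s0) - (s - t0 + s0) by lra.
    by apply: lip2; lra.
  rewrite (gl s)// (gr t)//; have h1 := lip1 _ _ spos st0 t0l1.
  have h2 : `|g2 (t - t0 + s0) - g2 s0| <= (t - t0 + s0) - s0.
    by apply: lip2; lra.
  rewrite g2s0 in h2.
  have := ler_distD (g1 t0) (g2 (t - t0 + s0)) (g1 s); lra.
- move=> s t spos st tl; have [tt0|tt0] := leP t t0.
    by rewrite !gl//; [apply: inj1|]; lra.
  have [st0|/ltW st0] := leP s t0; last first.
    by rewrite !gr//; [apply: inj2|]; lra.
  rewrite (gl s)// (gr t) ?(ltW tt0)// => e.
  have ss0 : s = t0.
    apply/eqP; rewrite eq_le st0 minS//; split; first by rewrite spos; lra.
    by exists (t - t0 + s0) => //=; rewrite in_itv /=; lra.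
  by apply: (inj2 s0 (t - t0 + s0)); rewrite -?e ?ss0//; lra.
Qed.

End lipschitz_arcs.

(** * Linking points by short arcs far from the boundary *)

Section linked_points.
Context (R : realType) (E : normedModType R) (G : set E).
Hypotheses (domG : domain G) (properG : G `<` setT).
Implicit Types (gamma : R -> E) (a b t : R) (x y z p q : E) (L A r : R).

Definition linked x y L r := exists g l,
  [/\ lip_arc g l x y, l <= L &
      forall t, 0 <= t <= l -> G (g t) /\ r <= bdist G (g t)].

(** Half of the uniformity condition: along an arc that starts at [x], the
    distance to the boundary grows at least linearly with the length. *)
Definition coned A x y L := exists g l,
  [/\ lip_arc g l x y, l <= L &
      forall t, 0 <= t <= l -> G (g t) /\ t <= A * bdist G (g t)].

Lemma linked_weaken x y L L' r r' : L <= L' -> r' <= r ->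
  linked x y L r -> linked x y L' r'.
Proof.
move=> LL rr [g [l [arc lL far]]]; exists g, l; split => //.
  exact: le_trans LL.
by move=> t /far[? ?]; split => //; exact: le_trans rr _.
Qed.

Lemma linked_segment p q r : G p -> 0 < r -> r + `|q - p| <= bdist G p ->
  linked p q `|q - p| r.
Proof.
move=> Gp r0 rd; have arc := lip_arc_segment p q.
eexists; eexists; split; [exact: arc|exact: lexx|move=> t /andP[t0 tl]].
case: arc => _ g0 _ lip _; have := lip 0 t (lexx _) t0 tl.
set w := _ (t / _ *: _); rewrite mul0r scale0r addr0 subr0 => wp.
have lip' := bdist_lip domG properG p w.
by split; [apply: (ball_bdist domG Gp)|]; rewrite distrC in wp *; lra.
Qed.

Lemma linked_trans x y z L1 L2 r :
  linked x y L1 r -> linked y z L2 r -> linked x z (L1 + L2) r.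
Proof.
move=> [g1 [l1 [arc1 lL1 far1]]] [g2 [l2 [arc2 lL2 far2]]].
have [g [l [arc [ll gP]]]] := lip_arc_join arc1 arc2.
exists g, l; split => // [|t tl]; first lra.
have [[tl1 ->]|[s [sl ->] _]] := gP t tl; last exact: far2.
by apply: far1; rewrite tl1 andbT; case/andP: tl.
Qed.

Lemma linked_coned A x y L r : 0 <= A -> L <= A * r ->
  linked x y L r -> coned A x y L.
Proof.
move=> A0 LA [g [l [arc lL far]]]; exists g, l; split => // t tl.
have [Gt rt] := far t tl; split => //.
have /andP[_ tl'] := tl; have := ler_wpM2l A0 rt; lra.
Qed.

Lemma coned_linked A x y z L1 L2 r : 0 <= A -> L1 + L2 <= A * r ->
  coned A x y L1 -> linked y z L2 r -> coned A x z (L1 + L2).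
Proof.
move=> A0 LA [g1 [l1 [arc1 lL1 far1]]] [g2 [l2 [arc2 lL2 far2]]].
have [g [l [arc [ll gP]]]] := lip_arc_join arc1 arc2.
exists g, l; split => // [|t tl]; first lra.
have [[tl1 ->]|[s [sl ->] [ts _]]] := gP t tl.
  by apply: far1; rewrite tl1 andbT; case/andP: tl.
have [Gs rs] := far2 s sl; split => //.
have /andP[_ ?] := sl; have := ler_wpM2l A0 rs; lra.
Qed.

(** A curve of finite length may have self-intersections, so an arc is drawn
    out of it by inscribing small segments and joining them: the set of [t]
    for which [gamma a] is linked to [gamma t] has its supremum at [b], since
    around any parameter [gamma] stays in a ball of [G] of radius [r]. The
    lengths of the segments are paid for by the length of [gamma], and the
    segments stay within [r] of the curve. *)
Lemma linked_curve gamma a b x y len r : curve_in G gamma a b x y ->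
  rectifiable_length gamma a b len -> 0 < r ->
  (forall t, a <= t <= b -> 2 * r <= bdist G (gamma t)) ->
  linked x y (len b) r.
Proof.
move=> [ab cont sub <- <-] [_ len0 lenD] r0 far.
have Gg t : a <= t <= b -> G (gamma t).
  by move=> tab; apply: sub; exists t => //=; rewrite in_itv.
pose T := [set t | a <= t <= b /\ linked (gamma a) (gamma t) (len t) r].
have Ta : T a.
  split; first by rewrite lexx ab.
  have Ga : a <= a <= b by rewrite lexx ab.
  have := @linked_segment (gamma a) (gamma a) r (Gg _ Ga) r0.
  rewrite subrr normr0 addr0 len0; apply; have := far a Ga; lra.
have supT : has_sup T by split; [exists a|exists b => t [/andP[]]].
have aT : a <= sup T by apply: ub_le_sup => //; case: supT.
have Tb : sup T <= b by apply: ge_sup => [|t [/andP[]]//]; exists a.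
have /within_itv_continuousP/(_ (sup T) (r / 2)) := cont.
rewrite aT Tb divr_gt0// => /(_ isT isT)[h h0 near].
have [s Ts sT] := sup_adherent h0 supT.
have [/andP[as_ sb] ls] := Ts.
have sT' : s <= sup T by apply: ub_le_sup => //; case: supT.
pose t := Num.min b (sup T + h / 2).
have tb : t <= b by rewrite ge_min lexx.
have tT : t <= sup T + h / 2 by rewrite ge_min lexx orbT.
have Tt : sup T <= t by rewrite le_min Tb /=; lra.
have Gs : a <= s <= b by rewrite as_.
have Gt : a <= t <= b by rewrite tb (le_trans aT).
have st : s <= t by exact: le_trans Tt.
have ds : `|gamma (sup T) - gamma s| < r / 2.
  by apply: near => //; rewrite ger0_norm ?subr_ge0//; lra.
have dt : `|gamma (sup T) - gamma t| < r / 2.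
  by apply: near => //; rewrite distrC ger0_norm ?subr_ge0//; lra.
have dst : `|gamma t - gamma s| < r.
  have := ler_distD (gamma (sup T)) (gamma t) (gamma s).
  rewrite (distrC (gamma t) (gamma (sup T))); lra.
have Ttt : T t.
  split => //; apply: linked_weaken (lenD _ _ as_ st tb) (lexx r) _.
  apply: linked_trans ls _; apply: linked_segment => //; first exact: Gg.
  have := far s Gs; lra.
have tT' : t <= sup T by apply: ub_le_sup => //; case: supT.
suff <- : t = b by case: Ttt.
by move: tT'; rewrite /t /Num.min; case: ifP => // _; lra.
Qed.

(** The scale-invariant form in which [psi]-uniformity enters the construction
    of arcs; [4] is large enough for consecutive points of a chain and for the
    two ends of the chains that start at [x] and [y]. *)
Definition linkable c C := forall p q rho, G p -> G q -> 0 < rho ->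
  rho <= c * bdist G p -> rho <= c * bdist G q -> `|p - q| <= 4 * rho ->
  linked p q (C * rho) (rho / C).

(** If [bdist G q] is large compared with
    [rho], a segment does. Otherwise the relative distance of [p] and [q] is at
    most [4 * c], so there is a curve from [p] to [q] of quasihyperbolic length
    at most [K := psi (4 * c) + 1], the added [1] making room for an infimum
    that is perhaps not attained; by [curve_integral_growth] its length is at
    most [expR K * bdist G q], which is comparable with [rho], and its distance
    to the boundary is at least [expR (- K) * bdist G p]. *)
Lemma psi_uniform_linkable (psi : R -> R) c : 1 <= c ->
  increasing_homeomorphism psi -> psi_uniform psi G ->
  exists2 C, 1 <= C & linkable c C.
Proof.
move=> c1 [[_ [[psi_ge0 _ _ _] _]] psi_mono] psiG.
have c0 : 0 < c by lra.
pose K := psi (4 * c) + 1.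
have K0 : 0 <= K.
  have : `[0, +oo[%classic (4 * c) by rewrite /= in_itv /= andbT; lra.
  by move/psi_ge0; rewrite /= in_itv /= andbT /K; lra.
have e1 : 1 <= expR K by have := expR_ge1Dx K; lra.
have e0 : 0 < expR K by exact: expR_gt0.
pose C := 12 * (c * expR K).
have ce1 : 1 <= c * expR K by nra.
have C1 : 1 <= C by rewrite /C; lra.
have C0 : 0 < C by lra.
exists C => // p q rho Gp Gq rho0 rp rq pq.
have rC : rho / C <= rho by rewrite ler_pdivrMr//; nra.
have Cr : rho <= C * rho by nra.
have [far|near] := leP (12 * rho) (bdist G q).
  have := bdist_lip domG properG q p; rewrite distrC => lip.
  apply: (@linked_weaken _ _ `|q - p| _ rho) => //.
    by rewrite distrC; rewrite /C in Cr *; nra.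
  by apply: linked_segment => //; rewrite distrC; lra.
have dp := bdist_gt0 domG properG Gp; have dq := bdist_gt0 domG properG Gq.
set m := Num.min (bdist G p) (bdist G q).
have m0 : 0 < m by rewrite lt_min dp dq.
have rm : rho <= c * m by rewrite /m /Num.min; case: ifP.
have rel0 : 0 <= relative_distance G p q by rewrite divr_ge0// ltW.
have rel4 : relative_distance G p q <= 4 * c.
  rewrite /relative_distance -/m ler_pdivrMr//; lra.
have psi4 : psi (relative_distance G p q) <= psi (4 * c).
  move: rel4; rewrite le_eqVlt => /predU1P[->//|rel4].
  apply/ltW/psi_mono => //; rewrite in_itv /= andbT//; lra.
have : (quasihyperbolic G p q < K%:E)%E.
  by apply: le_lt_trans (psiG _ _ Gp Gq) _; rewrite lte_fin /K; lra.
move=> /ereal_inf_lt[_ [gamma [a [b [crv fin ->]]]] /ltW leK].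
have [ab _ _ ga gb] := crv; pose len t := fine (curve_length gamma a t).
have rl : rectifiable_length gamma a b len by exact: curve_length_finite.
have grow := curve_integral_growth domG properG crv rl leK.
have [_ len0 lenD] := rl.
have lenb : len b <= C * rho.
  have := grow b; rewrite ab lexx gb => /(_ isT); rewrite /C => h.
  have : expR K * bdist G q <= expR K * (12 * rho) by rewrite ler_pM2l// ltW.
  have : expR K * rho <= c * (expR K * rho).
    by rewrite ler_peMl// mulr_ge0// ltW.
  lra.
apply: linked_weaken lenb (lexx _) _; apply: linked_curve crv rl _ _.
  by rewrite divr_gt0.
move=> t tab; have /andP[at_ tb] := tab.
have h1 := grow t tab; have h2 := lenD a t (lexx _) at_ tb.
have h3 := bdist_lip domG properG p (gamma t).
rewrite len0 add0r ga distrC in h2.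
have h4 : bdist G p <= expR K * bdist G (gamma t) by lra.
have h5 : rho <= c * expR K * bdist G (gamma t).
  by rewrite -mulrA; apply: le_trans rp _; rewrite ler_pM2l.
rewrite mulrA ler_pdivrMr// /C; nra.
Qed.

End linked_points.

(** * Uniformity conditions *)

Section uniformity.
Context (R : realType) (E : normedModType R) (G : set E).
Hypotheses (domG : domain G) (properG : G `<` setT).
Implicit Types (gamma : R -> E) (a b t : R) (x y z p q : E) (c C : R).

Lemma dist_le_diam (A : set E) x y : A x -> A y -> (`|x - y|%:E <= diam A)%E.
Proof. by move=> Ax Ay; apply: ereal_sup_ubound; exists x => //; exists y. Qed.

(** The form in which diameter uniformity enters the construction: at each
    scale [rho], seen from [x], there is a point about as far from the boundary
    as from [x]. *)
Definition has_thick_points c := forall x y rho, G x -> G y -> 0 <= rho ->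
  2 * rho <= `|x - y| ->
  exists z, [/\ G z, `|z - x| = rho & rho <= c * bdist G z].

(** The arc from [x] to [y] crosses the sphere of radius [rho] around [x]; the
    crossing point is at distance [rho] from [x] and at least [rho] from [y],
    so both subarcs that it bounds have diameter at least [rho]. *)
Lemma diameter_uniform_thick_points c :
  diameter_uniform c G -> has_thick_points c.
Proof.
move=> duG x y rho Gx Gy rho0 rhoxy.
have [gamma [a [b [[[ab cont sub ga gb] _] _ thick]]]] := duG x y Gx Gy.
have cdist : {within `[a, b], continuous (fun t => `|gamma t - x|)}.
  apply/within_itv_continuousP => t e tab e0.
  have [h h0 H] := (within_itv_continuousP _ _ _).1 cont t e tab e0.
  exists h => // s sab ts; apply: le_lt_trans (H s sab ts).
  apply: le_trans (ler_dist_dist _ _) _.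
  by rewrite opprD addrACA opprK addNr addr0.
rewrite distrC in rhoxy.
have [t tab dist] : exists2 t, t \in `[a, b] & `|gamma t - x| = rho.
  apply: (IVT ab cdist); rewrite ga gb subrr normr0.
  by rewrite ge_min le_max rho0/= (le_trans _ rhoxy) ?orbT//; lra.
exists (gamma t); split => //; first by apply: sub; exists t.
rewrite -lee_fin; apply: le_trans (thick t tab); rewrite le_min.
move: (tab); rewrite in_itv /= => /andP[at_ tb].
have xA : (gamma @` `[a, t]) (gamma a) by exists a; rewrite //= in_itv /= lexx.
have tA : (gamma @` `[a, t]) (gamma t).
  by exists t; rewrite //= in_itv /= lexx andbT.
have yA : (gamma @` `[t, b]) (gamma b).
  by exists b; rewrite //= in_itv /= lexx andbT.
have tA' : (gamma @` `[t, b]) (gamma t) by exists t; rewrite //= in_itv /= lexx.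
apply/andP; split.
  by apply: le_trans (dist_le_diam tA xA); rewrite ga dist.
apply: le_trans (dist_le_diam yA tA'); rewrite lee_fin gb.
have := ler_distD (gamma t) y x; lra.
Qed.

(** Induction over the scales [rho / 2 ^ n], ..., [rho / 2], [rho]. At the
    smallest scale the thick point lies in the ball of radius
    [bdist G x / 2], and a segment from [x] reaches it. Consecutive thick points
    are linkable, and the lengths of the links form a geometric series, so that
    the total length up to scale [rho] is still at most [2 * C * rho], while the
    links at that scale are at distance at least [rho / (2 * C)] from the
    boundary. *)
Lemma coned_thick_point c C x y n rho : 1 <= C -> linkable G c C ->
  has_thick_points c -> G x -> G y -> 0 < rho ->
  2 * rho <= `|x - y| -> 2 * rho <= 2 ^+ n * bdist G x ->
  exists z, [/\ G z, `|z - x| = rho, rho <= c * bdist G z &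
    coned G (3 * C ^+ 2) x z (2 * C * rho)].
Proof.
move=> C1 link thick Gx Gy; have C0 : 0 < C by lra.
have A0 : 0 <= 3 * C ^+ 2 by rewrite mulr_ge0// exprn_ge0// ltW.
elim: n rho => [|n IH] rho rho0 rxy rn.
  have [z [Gz zx rz]] := thick x y rho Gx Gy (ltW rho0) rxy.
  exists z; split => //.
  have [g [l [arc lr cone]]] : coned G (3 * C ^+ 2) x z rho.
    apply: (@linked_coned _ _ _ _ _ _ _ rho) => //.
      by rewrite ler_peMl ?(ltW rho0)//; nra.
    have := @linked_segment _ _ _ domG properG x z rho Gx rho0.
    by rewrite zx; apply; move: rn; rewrite expr0; lra.
  exists g, l; split => //; apply: le_trans lr _; nra.
have h0 : 0 < rho / 2 by lra.
have [z' [Gz' zx' rz' cone]] : exists z, [/\ G z, `|z - x| = rho / 2,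
    rho / 2 <= c * bdist G z & coned G (3 * C ^+ 2) x z (2 * C * (rho / 2))].
  apply: IH => //; first lra.
  by move: rn; rewrite exprS; lra.
have [z [Gz zx rz]] := thick x y rho Gx Gy (ltW rho0) rxy.
exists z; split => //.
have zz : linked G z' z (C * (rho / 2)) (rho / 2 / C).
  apply: link => //; first lra.
  have := ler_distD x z' z; rewrite (distrC x z); lra.
have [|g [l [arc lr cone']]] := coned_linked A0 _ cone zz.
  have -> : 3 * C ^+ 2 * (rho / 2 / C) = 3 * C * (rho / 2).
    by field; rewrite gt_eqF.
  lra.
exists g, l; split => //; have : 0 < C * rho by rewrite mulr_gt0.
lra.
Qed.

(** Two arcs that climb from [x] and from [y] up to the scale
    [rho := `|x - y| / 2] end at points at distance at most [4 * rho] from each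
    other, and a last link joins them. *)
Lemma linkable_thick_uniform c C : 1 <= C -> linkable G c C ->
  has_thick_points c -> uniform_domain (3 * C ^+ 2) G.
Proof.
move=> C1 link thick x y Gx Gy; have C0 : 0 < C by lra.
set A := 3 * C ^+ 2; have A0 : 0 <= A by rewrite mulr_ge0// exprn_ge0// ltW.
suff [g [l [arc lA cone]]] : exists g l,
    [/\ lip_arc g l x y, l <= A * `|x - y| &
    forall t, 0 <= t <= l -> G (g t) /\
      (t <= A * bdist G (g t) \/ l - t <= A * bdist G (g t))].
  have [l0 g0 gl lip inj] := arc; exists g, 0, l; split => //.
  - split; last first.
      move=> s t; rewrite !in_itv /= => /andP[s0 sl] /andP[t0 tl] e.
      by have [st|st|//] := ltgtP s t; [case: (inj s t)|case: (inj t s)].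
    split => //; first exact: lip_arc_continuous arc.
    by move=> _ [t + <-]; rewrite /= in_itv /= => /cone[].
  - by apply: le_trans (curve_length_lipschitz l0 lip) _; rewrite subr0 lee_fin.
  - move=> t; rewrite in_itv /= => tl; have [t0 tl'] := andP tl.
    have [_ [tA|tA]] := cone t tl; rewrite ge_min; apply/orP; [left|right].
      apply: le_trans (curve_length_lipschitz t0 _) _ => [s u s0 su ut|].
        by apply: lip => //; exact: le_trans tl'.
      by rewrite subr0 lee_fin.
    apply: le_trans (curve_length_lipschitz tl' _) _ => [s u s0 su ut|].
      by apply: lip => //; exact: le_trans s0.
    by rewrite lee_fin.
have [->|xy] := eqVneq x y.
  exists (fun t => y + (t / `|y - y|) *: (y - y)), `|y - y|.
  split; first exact: lip_arc_segment.
    by rewrite subrr normr0 mulr0.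
  move=> t; rewrite subrr scaler0 addr0 normr0 => /andP[t0 tl].
  split => //; left.
  by apply: le_trans tl _; rewrite mulr_ge0// ltW// bdist_gt0.
pose D := `|x - y|; have D0 : 0 < D by rewrite normr_gt0 subr_eq0.
pose rho := D / 2; have r0 : 0 < rho by rewrite /rho; lra.
have expn u : G u -> exists n, 2 * rho <= 2 ^+ n * bdist G u.
  move=> Gu; have du := bdist_gt0 domG properG Gu.
  exists (Num.truncn (2 * rho / bdist G u)).+1; rewrite -ler_pdivrMr//.
  apply: le_trans (ltW (truncnS_gt _)) _; rewrite -natrX ler_nat ltnW//.
  exact: ltn_expl.
have [n xn] := expn x Gx; have [m ym] := expn y Gy.
have r1 : 2 * rho <= `|x - y| by rewrite /rho -/D; lra.
have r2 : 2 * rho <= `|y - x| by rewrite distrC.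
have [z [Gz zx rz conex]] := coned_thick_point C1 link thick Gx Gy r0 r1 xn.
have [w [Gw wy rw coney]] := coned_thick_point C1 link thick Gy Gx r0 r2 ym.
have zw : linked G z w (C * rho) (rho / C).
  apply: link => //; have := ler_distD x z w; have := ler_distD y x w.
  by rewrite (distrC y w) -/D wy zx /rho; lra.
have [|g1 [l1 [arc1 lr1 cone1]]] := coned_linked A0 _ conex zw.
  have -> : A * (rho / C) = 3 * C * rho by rewrite /A; field; rewrite gt_eqF.
  lra.
have [g2 [l2 [/lip_arc_rev arc2 lr2 cone2]]] := coney.
have [g [l [arc [ll gP]]]] := lip_arc_join arc1 arc2.
exists g, l; split => //.
  apply: le_trans ll _; rewrite -/D /A.
  have -> : D = 2 * rho by rewrite /rho; lra.
  have Cr : 0 < C * rho by rewrite mulr_gt0.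
  have : C * rho <= C ^+ 2 * rho by rewrite expr2 -mulrA ler_peMl// ltW.
  lra.
move=> t tl; have [[tl1 ->]|[s [sl ->] [ts st]]] := gP t tl.
  have [] := cone1 t; first by rewrite tl1 andbT; case/andP: tl.
  by split => //; left.
have [] := cone2 (l2 - s); first by lra.
by rewrite st; split => //; right.
Qed.

Lemma scaling_homeomorphism (k : R) : 0 < k ->
  increasing_homeomorphism (fun t => k * t).
Proof.
move=> k0; split; last by move=> s t _ _ st; rewrite ltr_pM2l.
exists (fun t => k^-1 * t); split.
  split => [x|x|x _|x _].
  - by rewrite /= !in_itv /= !andbT => x0; rewrite mulr_ge0// ltW.
  - by rewrite /= !in_itv /= !andbT => x0; rewrite mulr_ge0// ltW ?invr_gt0.
  - by rewrite mulKf// gt_eqF.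
  - by rewrite mulVKf// gt_eqF.
by split; apply: continuous_subspaceT => x; apply: mulrl_continuous.
Qed.

(** A rough bound suffices since [psi] is arbitrary: the quasihyperbolic length
    of a curve is at most its length divided by its least distance to the
    boundary, and this gives a linear [psi]. *)
Lemma psi_uniform_scaling (M : R) : 0 < M ->
  (forall x y, G x -> G y -> exists gamma a b,
    [/\ curve_in G gamma a b x y,
        (curve_length gamma a b <= (M * `|x - y|)%:E)%E &
        forall t, a <= t <= b ->
          Num.min (bdist G x) (bdist G y) <= M * bdist G (gamma t)]) ->
  exists2 psi, increasing_homeomorphism psi & psi_uniform psi G.
Proof.
move=> M0 H; exists (fun t => M ^+ 2 * t).
  by apply: scaling_homeomorphism; rewrite exprn_gt0.
move=> x y Gx Gy; have [gamma [a [b [crv lenM far]]]] := H x y Gx Gy.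
rewrite /relative_distance; set m := Num.min _ _ in far *.
have m0 : 0 < m by rewrite lt_min !bdist_gt0.
have -> : M ^+ 2 * (`|x - y| / m) = M * `|x - y| / (m / M).
  by field; rewrite !gt_eqF.
apply: (quasihyperbolic_le crv lenM) => [|t tab]; first by rewrite divr_gt0.
by rewrite ler_pdivrMr// mulrC far.
Qed.

Lemma uniform_diameter_uniform c : uniform_domain c G -> diameter_uniform c G.
Proof.
move=> uG x y Gx Gy; have [gamma [a [b [arc len cone]]]] := uG x y Gx Gy.
exists gamma, a, b; split => //.
  exact: le_trans (diam_le_curve_length _ _ _) len.
move=> t tab; apply: le_trans (cone t tab).
by rewrite le_min !ge_min !diam_le_curve_length orbT.
Qed.

(** On a uniform arc the distance to the boundary does not drop much below
    its values at the endpoints: a point [w] of the arc is within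
    [c * bdist G w] of one of them, say of [x], so
    [bdist G x <= (1 + c) * bdist G w]. *)
Lemma uniform_psi_uniform c : 1 <= c -> uniform_domain c G ->
  exists2 psi, increasing_homeomorphism psi & psi_uniform psi G.
Proof.
move=> c1 uG; apply: (@psi_uniform_scaling (1 + c)); first lra.
move=> x y Gx Gy; have [gamma [a [b [[crv _] len cone]]]] := uG x y Gx Gy.
have [ab _ _ ga gb] := crv.
exists gamma, a, b; split => // [|t tab].
  apply: le_trans len _; rewrite lee_fin ler_wpM2r//; lra.
have [at_ tb] := andP tab; have := cone t; rewrite in_itv /= => /(_ tab).
rewrite ge_min ge_min => /orP[] le; apply/orP; [left|right].
  have := le_trans (dist_le_curve_length gamma (lexx a) at_ (lexx t)) le.
  rewrite ga lee_fin distrC.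
  have := bdist_lip domG properG x (gamma t); lra.
have := le_trans (dist_le_curve_length gamma (lexx t) tb (lexx b)) le.
rewrite gb lee_fin; have := bdist_lip domG properG y (gamma t); lra.
Qed.

Lemma convex_segment x y (k : R) : convex_set G -> G x -> G y ->
  0 <= k <= 1 -> G (x + k *: (y - x)).
Proof.
move=> cvxG Gx Gy /andP[k0 k1]; have := cvxG y x (Itv01 k0 k1).
rewrite !inE => /(_ Gy Gx); congr G.
transitivity (k *: y + (1 - k) *: x) => //.
by rewrite scalerBl scale1r addrCA -scalerBr.
Qed.

(** If the balls of radius [m] around [x] and [y] are in [G], then so is, by
    convexity, the ball of radius [m] around any point of the segment. *)
Lemma convex_bdist_segment x y (k : R) : convex_set G -> G x -> G y ->
  0 <= k <= 1 -> Num.min (bdist G x) (bdist G y) <= bdist G (x + k *: (y - x)).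
Proof.
move=> cvxG Gx Gy k01; set w := x + _.
apply: bdist_ball => // v wv.
have mx : Num.min (bdist G x) (bdist G y) <= bdist G x by rewrite ge_min lexx.
have my : Num.min (bdist G x) (bdist G y) <= bdist G y.
  by rewrite ge_min lexx orbT.
have Gx' : G (x + (v - w)).
  apply: (ball_bdist domG Gx); rewrite opprD addrA subrr add0r opprB.
  exact: lt_le_trans wv mx.
have Gy' : G (y + (v - w)).
  apply: (ball_bdist domG Gy); rewrite opprD addrA subrr add0r opprB.
  exact: lt_le_trans wv my.
have := convex_segment cvxG Gx' Gy' k01.
have -> : y + (v - w) - (x + (v - w)) = y - x.
  by rewrite (opprD x (v - w)) addrACA subrr addr0.
by rewrite addrAC -/w addrC subrK.
Qed.

(** Segments satisfy the hypothesis of [psi_uniform_scaling] with [M := 1], and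
    [psi] is the identity. *)
Lemma convex_psi_uniform : convex_set G ->
  exists2 psi, increasing_homeomorphism psi & psi_uniform psi G.
Proof.
move=> cvxG; apply: (@psi_uniform_scaling 1); first exact: ltr01.
move=> x y Gx Gy; have arc := lip_arc_segment x y.
have [l0 g0 gl lip _] := arc.
set g := fun t => _ in arc g0 gl lip.
have tl01 t : 0 <= t <= `|y - x| -> 0 <= t / `|y - x| <= 1.
  move=> /andP[t0 tl]; rewrite divr_ge0//=; have [->|yx] := eqVneq `|y - x| 0.
    by rewrite invr0 mulr0 ler01.
  by rewrite ler_pdivrMr ?mul1r// lt_neqAle eq_sym yx normr_ge0.
exists g, 0, `|y - x|; split => [||t /tl01 t01].
- split => //; first exact: lip_arc_continuous arc.
  move=> _ [t + <-]; rewrite /= in_itv /= => /tl01 t01.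
  exact: convex_segment cvxG Gx Gy t01.
- rewrite mul1r (distrC x); have := curve_length_lipschitz l0 lip.
  by rewrite subr0.
- by rewrite mul1r; exact: convex_bdist_segment.
Qed.

Lemma diameter_psi_uniform c (psi : R -> R) : 1 <= c -> diameter_uniform c G ->
  increasing_homeomorphism psi -> psi_uniform psi G ->
  exists2 c', 1 <= c' & uniform_domain c' G.
Proof.
move=> c1 duG psih psiG.
have [C C1 link] := psi_uniform_linkable domG properG c1 psih psiG.
exists (3 * C ^+ 2); first by nra.
exact: linkable_thick_uniform C1 link (diameter_uniform_thick_points duG).
Qed.

End uniformity.

Unset Implicit Arguments.

Theorem corollary1p2 (R : realType) (E : completeNormedModType R)
    (dimE : dim_ge E 2) (G : set E) (domG : domain G) (properG : G `<` setT) :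
  ((exists2 c : R, 1 <= c & uniform_domain c G) <->
     (exists2 c1 : R, 1 <= c1 & diameter_uniform c1 G) /\
     (exists2 psi : R -> R,
        increasing_homeomorphism psi & psi_uniform psi G)) /\
  (convex_set G ->
     (exists2 c1 : R, 1 <= c1 & diameter_uniform c1 G) ->
     exists2 c : R, 1 <= c & uniform_domain c G).
Proof.
split; first split.
- move=> [c c1 uG]; split.
    by exists c => //; exact: uniform_diameter_uniform.
  have [psi psih psiG] := uniform_psi_uniform domG properG c1 uG.
  by exists psi.
- move=> [[c c1 duG] [psi psih psiG]].
  exact: (diameter_psi_uniform domG properG c1 duG psih psiG).
move=> cvxG [c c1 duG].
have [psi psih psiG] := convex_psi_uniform domG properG cvxG.
exact: (diameter_psi_uniform domG properG c1 duG psih psiG).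
Qed.
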